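(* Let $f$ be a partial multi-valued function on represented spaces with target represented space $Y$, and let $n,k\in\mathbb{N}$. Then the following are equivalent: (1) $f$ is $(n+1)$–low$_k$, i.e. $f\le_{sW}\mathrm{Low}_{k,n}$; (2) for every partial multi-valued function $g:\subseteq Y\rightrightarrows Z$ on represented spaces (with the same represented space $Y$ as input) that is $(k+1)$–computable, the composition $g\circ f$ is $(n+k+1)$–computable.
   Context: Baire space $\mathbb{N}^\mathbb{N}$ is represented by the identity. A representation of a set $X$ is a surjective partial function $\delta:\subseteq\mathbb{N}^\mathbb{N}\to X$; a represented space is a pair $(X,\delta)$. For $f:\subseteq(X,\delta_X)\rightrightarrows(Y,\delta_Y)$ a realizer is a single-valued partial $F:\subseteq\mathbb{N}^\mathbb{N}\to\mathbb{N}^\mathbb{N}$ with $\delta_Y(F(p))\in f(\delta_X(p))$ for all $p\in\mathrm{dom}(f\circ\delta_X)$ ($F\vdash f$). With $\langle p,q\rangle(2n)=p(n)$, $\langle p,q\rangle(2n+1)=q(n)$: $f\le_W g$ iff there are computable partial $H,K$ on Baire space such that $p\mapsto H\langle p,G(K(p))\rangle$ realizes $f$ for every $G\vdash g$; $f\le_{sW}g$ iff there are computable $H,K$ with $H\circ G\circ K\vdash f$ for every $G\vdash g$. Composition of multi-valued functions: $(g\circ f)(x)=\bigcup_{y\in f(x)}g(y)$, $\mathrm{dom}(g\circ f)=\{x\in\mathrm{dom}(f):f(x)\subseteq\mathrm{dom}(g)\}$. $\lim:\subseteq\mathbb{N}^\mathbb{N}\to\mathbb{N}^\mathbb{N}$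 maps $\langle p_0,p_1,\ldots\rangle$ (where $\langle p_0,p_1,\ldots\rangle(\langle i,j\rangle)=p_i(j)$ for a standard computable pairing) to $\lim_i p_i$ whenever it exists. $\lim^{\circ m}$ is the $m$-fold composition ($\lim^{\circ 0}=\mathrm{id}$). A multi-valued function $h$ on represented spaces is $(m+1)$–computable if $h\le_W\lim^{\circ m}$. $J:\mathbb{N}^\mathbb{N}\to\mathbb{N}^\mathbb{N}$, $p\mapsto p'$, is the Turing jump (characteristic function of the halting problem relative to $p$); it is injective and $J^{-1}$ denotes its partial inverse. $\mathrm{Low}_{k,n}:=(J^{-1})^{\circ k}\circ\lim^{\circ(n+k)}$. *)

(* Defs.v *)
From Stdlib Require Import Arith Lia ClassicalEpsilon.
From Stdlib Require Cantor.

Definition Baire : Type := nat -> nat.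

Notation "⟪ i , j ⟫" := (Cantor.to_nat (i, j)) (at level 0).

Definition join (p q : Baire) : Baire :=
  fun n => if Nat.even n then p (Nat.div2 n) else q (Nat.div2 n).

(* Partial recursive functions relative to an oracle.  Codes denote partial
    functions of one argument; several arguments are passed through the Cantor
    pairing. *)

Inductive code : Type :=
| Zero | Succ | Left | Right | Oracle
| Pair (a b : code)
| Comp (a b : code)
| Prec (a b : code)
| Mu (a : code).

(* Graph of the function h with h x 0 = A x and h x (i+1) = B ⟪x,⟪i, h x i⟫⟫. *)
Fixpoint prec_graph (A B : nat -> nat -> Prop) (x m v : nat) : Prop :=
  match m with
  | 0 => A x v
  | S i => exists u, prec_graph A B x i u /\ B ⟪x, ⟪i, u⟫⟫ v
  end.

(* [eval p c n v]: the computation of [c] with oracle [p] on input [n] halts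
   with output [v]. *)
Fixpoint eval (p : Baire) (c : code) (n v : nat) : Prop :=
  match c with
  | Zero => v = 0
  | Succ => v = S n
  | Left => v = fst (Cantor.of_nat n)
  | Right => v = snd (Cantor.of_nat n)
  | Oracle => v = p n
  | Pair a b => exists x y, eval p a n x /\ eval p b n y /\ v = ⟪x, y⟫
  | Comp a b => exists x, eval p b n x /\ eval p a x v
  | Prec a b =>
      prec_graph (eval p a) (eval p b)
        (fst (Cantor.of_nat n)) (snd (Cantor.of_nat n)) v
  | Mu a =>
      eval p a ⟪n, v⟫ 0 /\
      forall i, i < v -> exists u, eval p a ⟪n, i⟫ (S u)
  end.

(* Gödel numbering; it is a bijection between codes and natural numbers, see
   [encode_inj] and [encode_surj]. *)
Fixpoint encode (c : code) : nat :=
  match c with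
  | Zero => 0
  | Succ => 1
  | Left => 2
  | Right => 3
  | Oracle => 4
  | Pair a b => 5 + 4 * ⟪encode a, encode b⟫
  | Comp a b => 6 + 4 * ⟪encode a, encode b⟫
  | Prec a b => 7 + 4 * ⟪encode a, encode b⟫
  | Mu a => 8 + 4 * encode a
  end.

Lemma eval_functional p c n v w : eval p c n v -> eval p c n w -> v = w.
Proof.
  revert n v w; induction c; simpl; intros n v w Hv Hw; try congruence.
  - destruct Hv as (x & y & Hx & Hy & ->), Hw as (x' & y' & Hx' & Hy' & ->).
    now rewrite (IHc1 _ _ _ Hx Hx'), (IHc2 _ _ _ Hy Hy').
  - destruct Hv as (x & Hx & Hv), Hw as (x' & Hx' & Hw).
    rewrite (IHc2 _ _ _ Hx Hx') in Hv.
    eauto.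
  - revert v w Hv Hw; generalize (snd (Cantor.of_nat n)) as m.
    generalize (fst (Cantor.of_nat n)) as x.
    induction m as [|m IH]; simpl; intros v w Hv Hw; [eauto|].
    destruct Hv as (u & Hu & Hv), Hw as (u' & Hu' & Hw).
    rewrite (IH _ _ Hu Hu') in Hv; eauto.
  - destruct Hv as [Hv Lv], Hw as [Hw Lw].
    destruct (lt_eq_lt_dec v w) as [[L|E]|L]; [|exact E|].
    + destruct (Lw _ L) as [u Hu]; discriminate (IHc _ _ _ Hv Hu).
    + destruct (Lv _ L) as [u Hu]; discriminate (IHc _ _ _ Hw Hu).
Qed.

Lemma encode_inj c d : encode c = encode d -> c = d.
Proof.
  revert d; induction c; intros d; destruct d; cbn [encode]; intros E;
    try reflexivity; try (exfalso; lia).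
  1-3: match type of E with ?k + 4 * ?u = _ + 4 * ?v =>
         assert (E' : u = v) by lia end;
       apply Cantor.to_nat_inj in E'; injection E' as E1 E2;
       now rewrite (IHc1 _ E1), (IHc2 _ E2).
  f_equal; apply IHc; lia.
Qed.

Lemma encode_surj e : exists c, encode c = e.
Proof.
  induction e as [e IH] using (well_founded_induction lt_wf).
  destruct (Nat.lt_ge_cases e 5) as [L|L].
  { destruct e as [|[|[|[|[|e]]]]];
      [now exists Zero|now exists Succ|now exists Left|now exists Right
      |now exists Oracle|lia]. }
  pose proof (Nat.div_mod_eq (e - 5) 4) as E.
  pose proof (Nat.mod_upper_bound (e - 5) 4 ltac:(lia)) as B.
  set (d := (e - 5) / 4) in *; set (r := (e - 5) mod 4) in *.
  destruct (Nat.eq_dec r 3) as [R|R].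
  { destruct (IH d) as [a Ha]; [lia|]; exists (Mu a); cbn [encode]; lia. }
  destruct (Cantor.of_nat d) as [x y] eqn:Dxy.
  assert (D : ⟪x, y⟫ = d) by (rewrite <- Dxy; apply Cantor.cancel_to_of).
  pose proof (Cantor.to_nat_non_decreasing x y).
  destruct (IH x) as [a Ha]; [lia|]; destruct (IH y) as [b Hb]; [lia|].
  assert (C : r = 0 \/ r = 1 \/ r = 2) by lia.
  destruct C as [C|[C|C]];
    [exists (Pair a b)|exists (Comp a b)|exists (Prec a b)];
    cbn [encode]; rewrite Ha, Hb; lia.
Qed.

Definition pfun : Type := Baire -> option Baire.

(* Nothing is required of the code outside the domain of [F], as usual for
   type-2 computability. *)
Definition computable (F : pfun) : Prop :=
  exists c, forall p q, F p = Some q -> forall n, eval p c n (q n).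

Definition pcomp (G F : pfun) : pfun :=
  fun p => match F p with Some q => G q | None => None end.

Definition halts (p : Baire) (e : nat) : Prop :=
  exists c v, encode c = e /\ eval p c e v.

Definition J (p : Baire) : Baire :=
  fun e => if excluded_middle_informative (halts p e) then 1 else 0.

Record repspace : Type := RepSpace {
  carrier :> Type;
  rep : Baire -> option carrier;
  rep_surj : forall x, exists p, rep p = Some x
}.

Lemma baire_rep_surj (x : Baire) : exists p, Some p = Some x.
Proof. now exists x. Qed.

Canonical baire_space : repspace := RepSpace Baire (@Some Baire) baire_rep_surj.

(* [f x y] means y ∈ f(x); the domain of [f] is the set of x with f(x) ≠ ∅. *)
Definition multifun (X Y : repspace) : Type := X -> Y -> Prop.

Definition dom {X Y : repspace} (f : multifun X Y) (x : X) : Prop :=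
  exists y, f x y.

Definition mid {X : repspace} : multifun X X := fun x y => x = y.

Definition mcomp {X Y Z : repspace} (g : multifun Y Z) (f : multifun X Y) :
    multifun X Z :=
  fun x z => (forall y, f x y -> dom g y) /\ exists y, f x y /\ g y z.

Fixpoint miter {X : repspace} (f : multifun X X) (m : nat) : multifun X X :=
  match m with
  | 0 => mid
  | S m => mcomp f (miter f m)
  end.

Definition realizes {X Y : repspace} (F : pfun) (f : multifun X Y) : Prop :=
  forall p x, rep X p = Some x -> dom f x ->
    exists q y, F p = Some q /\ rep Y q = Some y /\ f x y.

Definition weihrauch_le {X Y U V : repspace}
    (f : multifun X Y) (g : multifun U V) : Prop :=
  exists H K : pfun, computable H /\ computable K /\
    forall G : pfun, realizes G g ->
      realizes (fun p => pcomp (fun r => H (join p r)) (pcomp G K) p) f.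

Definition strong_weihrauch_le {X Y U V : repspace}
    (f : multifun X Y) (g : multifun U V) : Prop :=
  exists H K : pfun, computable H /\ computable K /\
    forall G : pfun, realizes G g -> realizes (pcomp H (pcomp G K)) f.

(* The argument is P = ⟨p_0, p_1, ...⟩ with p_i(j) = P ⟪i, j⟫; convergence is in
   the product topology of the discrete space nat. *)
Definition lim : multifun baire_space baire_space :=
  fun P q => forall j, exists N, forall i, N <= i -> P ⟪i, j⟫ = q j.

(* Partial inverse of the (injective) jump. *)
Definition Jinv : multifun baire_space baire_space := fun p q => J q = p.

Definition Low (k n : nat) : multifun baire_space baire_space :=
  mcomp (miter Jinv k) (miter lim (n + k)).

(* [succ_computable m h] : h is (m+1)-computable. *)
Definition succ_computable {X Y : repspace} (m : nat) (h : multifun X Y) : Prop :=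
  weihrauch_le h (miter lim m).

(* [succ_low n k f] : f is (n+1)-low_k. *)
Definition succ_low {X Y : repspace} (n k : nat) (f : multifun X Y) : Prop :=
  strong_weihrauch_le f (Low k n).

(* Main.v *)
From Stdlib Require Import Arith Lia ClassicalEpsilon FunctionalExtensionality.
From Stdlib Require Cantor.
Require Import Defs.

(** The map g = J^k ∘ δ_Y^{-1} is the hardest (k+1)-computable map on Y: it is
    (k+1)-computable since J is a limit of computable functions, and conversely
    lim^k of anything computable from r can be computed from J^k(r), because J(q)
    is uniformly computable from J(p) whenever q is computable from p, and lim(p)
    from J(p). Hence a realizer of Low_{k,n}, whose inner part lim^(n+k) delivers
    J^k(r), already yields g ∘ f for every (k+1)-computable g. In the other
    direction, if J^k ∘ δ_Y^{-1} ∘ f is computable from p and lim^(n+k)(K(p)), then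
    the outer computation H can be pulled inside the limits: H ∘ lim = lim ∘ H'
    holds with H' obtained by running H on the rows with a growing bound on all
    searches. Then J^k of a name of f(x) is itself of the form lim^(n+k)(K'(p)),
    and applying J^{-k} recovers the name. *)

(** * Pairing and closure properties of total computable operators *)

Definition fstn (n : nat) : nat := fst (Cantor.of_nat n).
Definition sndn (n : nat) : nat := snd (Cantor.of_nat n).

Lemma fstn_pair x y : fstn ⟪x, y⟫ = x.
Proof. unfold fstn; now rewrite Cantor.cancel_of_to. Qed.

Lemma sndn_pair x y : sndn ⟪x, y⟫ = y.
Proof. unfold sndn; now rewrite Cantor.cancel_of_to. Qed.

Lemma pair_surj n : ⟪fstn n, sndn n⟫ = n.
Proof.
  unfold fstn, sndn; rewrite <- surjective_pairing; apply Cantor.cancel_to_of.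
Qed.

#[local] Opaque Cantor.to_nat Cantor.of_nat.
#[local] Hint Rewrite fstn_pair sndn_pair : pairing.
Ltac proj := autorewrite with pairing in *.

Definition computes (p : Baire) (c : code) (q : Baire) : Prop :=
  forall n, eval p c n (q n).

(** One code has to serve every oracle, so uniformity in [p] is built in. Treating oracle and number
    as two arguments of [F] lets the closure lemmas below be stated pointwise. *)
Definition total_computable (F : Baire -> Baire) : Prop :=
  exists c, forall p, computes p c (F p).

Lemma tc_ext F G :
  (forall p n, F p n = G p n) -> total_computable F -> total_computable G.
Proof. intros E [c Hc]; exists c; intros p n; rewrite <- E; apply Hc. Qed.

Lemma tc_comp F G : total_computable F -> total_computable G ->
  total_computable (fun p n => F p (G p n)).
Proof.
  intros [c Hc] [d Hd]; exists (Comp c d); intros p n; simpl.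
  exists (G p n); split; [apply Hd|apply Hc].
Qed.

Lemma tc_id : total_computable (fun _ n => n).
Proof.
  exists (Pair Left Right); intros p n; simpl.
  exists (fstn n), (sndn n); repeat split; now rewrite pair_surj.
Qed.

Lemma tc_const k : total_computable (fun _ _ => k).
Proof.
  induction k as [|k [c Hc]]; [now exists Zero|].
  exists (Comp Succ c); intros p n; exists k; split; [apply Hc|reflexivity].
Qed.

Lemma tc_oracle F : total_computable F -> total_computable (fun p n => p (F p n)).
Proof.
  intros H; apply (tc_comp (fun p n => p n) F); [now exists Oracle|exact H].
Qed.

Lemma tc_succ F : total_computable F -> total_computable (fun p n => S (F p n)).
Proof.
  intros H; apply (tc_comp (fun _ n => S n) F); [now exists Succ|exact H].
Qed.

Lemma tc_fstn F : total_computable F -> total_computable (fun p n => fstn (F p n)).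
Proof.
  intros H; apply (tc_comp (fun _ n => fstn n) F); [now exists Left|exact H].
Qed.

Lemma tc_sndn F : total_computable F -> total_computable (fun p n => sndn (F p n)).
Proof.
  intros H; apply (tc_comp (fun _ n => sndn n) F); [now exists Right|exact H].
Qed.

Lemma tc_pair F G : total_computable F -> total_computable G ->
  total_computable (fun p n => ⟪F p n, G p n⟫).
Proof.
  intros [c Hc] [d Hd]; exists (Pair c d); intros p n; simpl.
  exists (F p n), (G p n); split; [apply Hc|split; [apply Hd|reflexivity]].
Qed.

Definition prec (a : nat) (b : nat -> nat -> nat) (m : nat) : nat :=
  nat_rec (fun _ => nat) a b m.

Lemma prec_graph_total (A : nat -> nat) (B : nat -> nat) (GA GB : nat -> nat -> Prop) x m :
  (forall n, GA n (A n)) -> (forall n, GB n (B n)) ->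
  prec_graph GA GB x m (prec (A x) (fun i u => B ⟪x, ⟪i, u⟫⟫) m).
Proof.
  intros HA HB; induction m as [|m IH]; simpl; [apply HA|].
  eexists; split; [exact IH|apply HB].
Qed.

(** The step function is required to be computable on the packed argument ⟪n, ⟪i, u⟫⟫ that [Prec]
    passes to it. *)
Lemma tc_prec A B M : total_computable A ->
  total_computable (fun p t => B p (fstn t) (fstn (sndn t)) (sndn (sndn t))) ->
  total_computable M ->
  total_computable (fun p n => prec (A p n) (B p n) (M p n)).
Proof.
  intros HA HB HM.
  (* First the case where one input packs parameter and recursion length; composing with ⟪n, M p n⟫
     gives the general case. *)
  assert (H : total_computable (fun p t =>
     prec (A p (fstn t)) (B p (fstn t)) (sndn t))).
  { destruct HA as [a Ha], HB as [b Hb]; exists (Prec a b); intros p t; simpl.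
    pose proof (prec_graph_total (A p) _ (eval p a) (eval p b) (fstn t) (sndn t)
      (Ha p) (Hb p)) as H; simpl in H.
    replace (prec (A p (fstn t)) (B p (fstn t)) (sndn t)) with
      (prec (A p (fstn t)) (fun i u => B p (fstn ⟪fstn t, ⟪i, u⟫⟫)
         (fstn (sndn ⟪fstn t, ⟪i, u⟫⟫)) (sndn (sndn ⟪fstn t, ⟪i, u⟫⟫))) (sndn t));
      [exact H|].
    f_equal; do 2 (apply functional_extensionality; intro); now proj. }
  eapply tc_ext; [|exact (tc_comp _ _ H (tc_pair _ _ tc_id HM))].
  intros p n; simpl; now proj.
Qed.

Definition cond (a b c : nat) : nat := match a with 0 => b | S _ => c end.

(** Case distinction is a recursion of length [F p n] from [G p n] whose step constantly returns
    [H p n]. *)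
Lemma tc_cond F G H : total_computable F -> total_computable G ->
  total_computable H -> total_computable (fun p n => cond (F p n) (G p n) (H p n)).
Proof.
  intros HF HG HH.
  eapply tc_ext; [|apply (tc_prec G (fun p n _ _ => H p n) F HG)];
    [|apply (tc_comp H _ HH), tc_fstn, tc_id|exact HF].
  intros p n; cbv beta; now destruct (F p n).
Qed.

Lemma tc_pred F : total_computable F -> total_computable (fun p n => pred (F p n)).
Proof.
  intros HF.
  eapply tc_ext; [|apply (tc_prec (fun _ _ => 0) (fun _ _ i _ => i) F (tc_const 0))];
    [|apply tc_fstn, tc_sndn, tc_id|exact HF].
  intros p n; cbv beta; now destruct (F p n).
Qed.

Lemma tc_add F G : total_computable F -> total_computable G ->
  total_computable (fun p n => F p n + G p n).
Proof.
  intros HF HG.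
  eapply tc_ext; [|apply (tc_prec G (fun _ _ _ u => S u) F HG)];
    [|apply tc_succ, tc_sndn, tc_sndn, tc_id|exact HF].
  intros p n; cbv beta; induction (F p n) as [|m IH]; simpl; congruence.
Qed.

Lemma tc_sub F G : total_computable F -> total_computable G ->
  total_computable (fun p n => F p n - G p n).
Proof.
  intros HF HG.
  eapply tc_ext; [|apply (tc_prec F (fun _ _ _ u => pred u) G HF)];
    [|apply tc_pred, tc_sndn, tc_sndn, tc_id|exact HG].
  intros p n; cbv beta; induction (G p n) as [|m IH]; simpl; lia.
Qed.

(* Truth values are reversed throughout: 0 stands for true, as in [Mu] and [cond]. *)
Definition neqn (a b : nat) : nat := (a - b) + (b - a).

Lemma neqn_0 a b : neqn a b = 0 <-> a = b.
Proof. unfold neqn; lia. Qed.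

Lemma cond_eq a b x y : a = b -> cond (neqn a b) x y = x.
Proof. intros E; apply neqn_0 in E; now rewrite E. Qed.

Lemma cond_neq a b x y : a <> b -> cond (neqn a b) x y = y.
Proof. rewrite <- neqn_0; destruct (neqn a b); [easy|reflexivity]. Qed.

Lemma tc_neqn F G : total_computable F -> total_computable G ->
  total_computable (fun p n => neqn (F p n) (G p n)).
Proof. intros; apply tc_add; now apply tc_sub. Qed.

(* [tag] and [arg] decode Gödel numbers: [tag (encode c)] identifies the head
   constructor of c, and [arg] the number coding its arguments. *)
Definition tag (e : nat) : nat := prec 0 (fun _ u => cond (neqn u 8) 5 (S u)) e.

Definition arg (e : nat) : nat :=
  prec 0 (fun i u => cond (neqn (tag i) 8) (S u) u) e.

Lemma tc_tag F : total_computable F -> total_computable (fun p n => tag (F p n)).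
Proof.
  intros HF.
  apply (tc_prec (fun _ _ => 0) (fun _ _ _ u => cond (neqn u 8) 5 (S u)) F);
    [apply tc_const| |exact HF].
  apply tc_cond; [apply tc_neqn|..]; auto using tc_const, tc_succ, tc_sndn, tc_id.
Qed.

Lemma tc_arg F : total_computable F -> total_computable (fun p n => arg (F p n)).
Proof.
  intros HF.
  apply (tc_prec (fun _ _ => 0) (fun _ _ i u => cond (neqn (tag i) 8) (S u) u) F);
    [apply tc_const| |exact HF].
  apply tc_cond; [apply tc_neqn; [apply tc_tag|]|..];
    auto using tc_const, tc_succ, tc_sndn, tc_fstn, tc_id.
Qed.

Ltac tc :=
  lazymatch goal with
  | |- total_computable (fun p n => S (@?F p n)) => apply (tc_succ F); tc
  | |- total_computable (fun p n => fstn (@?F p n)) => apply (tc_fstn F); tc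
  | |- total_computable (fun p n => sndn (@?F p n)) => apply (tc_sndn F); tc
  | |- total_computable (fun p n => tag (@?F p n)) => apply (tc_tag F); tc
  | |- total_computable (fun p n => arg (@?F p n)) => apply (tc_arg F); tc
  | |- total_computable (fun p n => pred (@?F p n)) => apply (tc_pred F); tc
  | |- total_computable (fun p n => ⟪@?F p n, @?G p n⟫) => apply (tc_pair F G); tc
  | |- total_computable (fun p n => (@?F p n) + (@?G p n)) => apply (tc_add F G); tc
  | |- total_computable (fun p n => (@?F p n) - (@?G p n)) => apply (tc_sub F G); tc
  | |- total_computable (fun p n => neqn (@?F p n) (@?G p n)) => apply (tc_neqn F G); tc
  | |- total_computable (fun p n => cond (@?F p n) (@?G p n) (@?H p n)) =>
      apply (tc_cond F G H); tc
  | |- total_computable (fun p n => prec (@?A p n) (@?B p n) (@?M p n)) =>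
      apply (tc_prec A B M); cbv beta; tc
  | |- total_computable (fun p n => n) => apply tc_id
  | |- total_computable (fun _ _ => ?k) => apply (tc_const k)
  | |- total_computable (fun p n => p (@?F p n)) => apply (tc_oracle F); tc
  | |- _ => assumption
  end.

(** * Substitution for the oracle *)

Fixpoint subst (c d : code) : code :=
  match c with
  | Oracle => d
  | Pair a b => Pair (subst a d) (subst b d)
  | Comp a b => Comp (subst a d) (subst b d)
  | Prec a b => Prec (subst a d) (subst b d)
  | Mu a => Mu (subst a d)
  | _ => c
  end.

Lemma prec_graph_iff (A A' B B' : nat -> nat -> Prop) x m v :
  (forall n w, A n w <-> A' n w) -> (forall n w, B n w <-> B' n w) ->
  prec_graph A B x m v <-> prec_graph A' B' x m v.
Proof.
  intros HA HB; revert v; induction m as [|m IH]; intros v; simpl; [apply HA|].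
  split; intros (u & Hu & H); exists u; split; try apply IH; try apply HB; assumption.
Qed.

Lemma eval_subst p q c d n v :
  computes p d q -> eval p (subst c d) n v <-> eval q c n v.
Proof.
  intros Hd; revert n v; induction c; intros n v; simpl; try tauto.
  - split; [|intros ->; apply Hd].
    intros H; exact (eval_functional _ _ _ _ _ H (Hd n)).
  - split; intros (x & y & Hx & Hy & E); exists x, y;
      (split; [now apply IHc1|split; [now apply IHc2|exact E]]).
  - split; intros (x & Hx & Hy); exists x; (split; [now apply IHc2|now apply IHc1]).
  - now apply prec_graph_iff.
  - split; intros [H L]; (split; [now apply IHc|]);
      intros i Hi; destruct (L i Hi) as [u Hu]; exists u; now apply IHc.
Qed.

Lemma computes_subst p q r c d :
  computes p d q -> computes q c r -> computes p (subst c d) r.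
Proof. intros Hd Hc n; apply (eval_subst p q); auto. Qed.

Lemma tc_subst F G : total_computable F -> total_computable G ->
  total_computable (fun p => F (G p)).
Proof.
  intros [c Hc] [d Hd]; exists (subst c d); intros p.
  now apply (computes_subst p (G p)).
Qed.

Lemma computes_functional p c q r : computes p c q -> computes p c r -> q = r.
Proof.
  intros Hq Hr; apply functional_extensionality; intros n.
  exact (eval_functional _ _ _ _ _ (Hq n) (Hr n)).
Qed.

(** Totality of [F] makes every test of the search defined, so the clause for [Mu] reduces to
    nonzero values below [v]. *)
Lemma eval_mu F : total_computable F -> exists c, forall p n v,
  eval p c n v <-> F p ⟪n, v⟫ = 0 /\ forall i, i < v -> F p ⟪n, i⟫ <> 0.
Proof.
  intros [c Hc]; exists (Mu c); intros p n v; simpl.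
  split; intros [H L]; split.
  - exact (eval_functional _ _ _ _ _ (Hc p _) H).
  - intros i Hi E; destruct (L i Hi) as [u Hu].
    pose proof (eval_functional _ _ _ _ _ (Hc p _) Hu); congruence.
  - rewrite <- H; apply Hc.
  - intros i Hi; exists (pred (F p ⟪n, i⟫)); specialize (L i Hi).
    replace (S (pred (F p ⟪n, i⟫))) with (F p ⟪n, i⟫) by lia; apply Hc.
Qed.

Lemma least_witness (P : nat -> Prop) :
  (exists n, P n) -> exists n, P n /\ forall i, i < n -> ~ P i.
Proof.
  intros [n Hn]; induction n as [n IH] using (well_founded_induction lt_wf).
  destruct (classic (exists i, i < n /\ P i)) as [(i & L & Hi)|N]; [eauto|].
  exists n; split; [exact Hn|]; intros i L Hi; apply N; eauto.
Qed.

(** Every condition of the form: some [v] passes a computable test, becomes a halting condition.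
    This is how questions are put to the jump later. *)
Lemma eval_mu_halts F : total_computable F -> exists c, forall p n,
  (exists v, eval p c n v) <-> exists v, F p ⟪n, v⟫ = 0.
Proof.
  intros HF; destruct (eval_mu F HF) as [c Hc]; exists c; intros p n; split.
  - intros [v Hv]; apply Hc in Hv; now exists v.
  - intros H; apply least_witness in H; destruct H as [v Hv].
    exists v; now apply Hc.
Qed.

(** * Bounded evaluation and limits *)

(* Unbounded search is cut off at [b]; the value 0 means that no result was
   found and S v means the result v. In the search, the state is 0 while running,
   1 once an undefined value was met, and S (S v) once v was found. *)
Fixpoint bev (q : Baire) (b : nat) (c : code) (n : nat) : nat :=
  match c with
  | Zero => 1
  | Succ => S (S n)
  | Left => S (fstn n)
  | Right => S (sndn n)
  | Oracle => S (q n)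
  | Pair c d =>
      cond (bev q b c n) 0
        (cond (bev q b d n) 0 (S ⟪pred (bev q b c n), pred (bev q b d n)⟫))
  | Comp c d => cond (bev q b d n) 0 (bev q b c (pred (bev q b d n)))
  | Prec c d =>
      prec (bev q b c (fstn n))
        (fun i u => cond u 0 (bev q b d ⟪fstn n, ⟪i, pred u⟫⟫)) (sndn n)
  | Mu c =>
      pred (prec 0 (fun i u =>
        cond u (cond (bev q b c ⟪n, i⟫) 1
                  (cond (pred (bev q b c ⟪n, i⟫)) (S (S i)) 0)) u) b)
  end.

Definition row (P : Baire) (i : nat) : Baire := fun j => P ⟪i, j⟫.

(** With the search cut off, evaluation is primitive recursive in the oracle. The row index also
    serves as the search bound, so a single parameter going to infinity refines both. *)
Lemma bev_computable c :
  total_computable (fun P t => bev (row P (fstn t)) (fstn t) c (sndn t)).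
Proof.
  induction c; simpl; unfold row; try solve [tc].
  - apply tc_cond; [exact IHc2|tc|].
    eapply tc_ext; [|exact (tc_comp _ _ IHc1
       (tc_pair _ _ (tc_fstn _ tc_id) (tc_pred _ IHc2)))].
    intros p n; simpl; now proj.
  - apply (tc_prec (fun P t => bev (row P (fstn t)) (fstn t) c1 (fstn (sndn t)))
     (fun P t i u => cond u 0 (bev (row P (fstn t)) (fstn t) c2
                       ⟪fstn (sndn t), ⟪i, pred u⟫⟫)) (fun P t => sndn (sndn t))).
    + eapply tc_ext; [|apply (tc_comp _ (fun P t => ⟪fstn t, fstn (sndn t)⟫) IHc1); tc].
      intros p n; simpl; now proj.
    + apply tc_cond; [tc|tc|].
      eapply tc_ext; [|apply (tc_comp _ (fun P s => ⟪fstn (fstn s),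
         ⟪fstn (sndn (fstn s)), ⟪fstn (sndn s), pred (sndn (sndn s))⟫⟫⟫) IHc2); tc].
      intros p n; simpl; now proj.
    + tc.
  - apply tc_pred.
    apply (tc_prec (fun P t => 0)
     (fun P t i u =>
        cond u (cond (bev (row P (fstn t)) (fstn t) c ⟪sndn t, i⟫) 1
          (cond (pred (bev (row P (fstn t)) (fstn t) c ⟪sndn t, i⟫)) (S (S i)) 0)) u)
     (fun P t => fstn t)); [tc| |tc].
    assert (H : total_computable (fun P s =>
      bev (row P (fstn (fstn s))) (fstn (fstn s)) c ⟪sndn (fstn s), fstn (sndn s)⟫)).
    { eapply tc_ext; [|apply (tc_comp _ (fun P s => ⟪fstn (fstn s),
         ⟪sndn (fstn s), fstn (sndn s)⟫⟫) IHc); tc].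
      intros p n; simpl; now proj. }
    apply tc_cond; [tc| |tc]; apply tc_cond; [exact H|tc|].
    apply tc_cond; [now apply tc_pred|tc|tc].
Qed.

Lemma bev_sound q b c n v : bev q b c n = S v -> eval q c n v.
Proof.
  revert n v; induction c; simpl; intros n v H; try (injection H as <-; reflexivity).
  - destruct (bev q b c1 n) as [|x] eqn:E1; [discriminate|].
    destruct (bev q b c2 n) as [|y] eqn:E2; [discriminate|].
    injection H as <-; exists x, y; auto.
  - destruct (bev q b c2 n) as [|x] eqn:E2; [discriminate|].
    exists x; auto.
  - revert v H; change (fst (Cantor.of_nat n)) with (fstn n).
    change (snd (Cantor.of_nat n)) with (sndn n).
    induction (sndn n) as [|m IH]; simpl; intros v H; [auto|].
    destruct (prec _ _ m) as [|u]; [discriminate|]; exists u; auto.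
  - match type of H with pred (prec _ ?B _) = _ => set (st := B) in H end.
    (* Invariant after [k] rounds: state 0 means that all tests so far were defined and nonzero;
       state S (S w) means that [w] is the first zero. *)
    assert (I : forall k, (prec 0 st k = 0 -> forall i, i < k -> exists u,
                   bev q b c ⟪n, i⟫ = S (S u)) /\
                (forall w, prec 0 st k = S (S w) -> bev q b c ⟪n, w⟫ = 1 /\
                   forall i, i < w -> exists u, bev q b c ⟪n, i⟫ = S (S u))).
    { induction k as [|k [I0 I1]]; [split; [lia|discriminate]|].
      change (prec 0 st (S k)) with (st k (prec 0 st k)); unfold st at 1 3.
      destruct (prec 0 st k) as [|z]; simpl.
      - destruct (bev q b c ⟪n, k⟫) as [|[|u]] eqn:E; simpl;
          (split; [|intros w Hw]); try discriminate.
        + injection Hw as <-; auto.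
        + intros _ i Hi; destruct (Nat.eq_dec i k) as [->|]; [eauto|].
          apply I0; [reflexivity|lia].
      - split; [discriminate|exact I1]. }
    destruct (I b) as [_ I1].
    destruct (I1 v) as [I2 I3]; [lia|].
    split; [auto|]; intros i Hi; destruct (I3 i Hi) as [u Hu]; eauto.
Qed.

(** Supplies one threshold for the finitely many failed tests that precede the result of a
    search. *)
Lemma eventually_bounded (Q : nat -> nat -> Prop) m :
  (forall i, i < m -> exists N, forall k, N <= k -> Q i k) ->
  exists N, forall i k, i < m -> N <= k -> Q i k.
Proof.
  induction m as [|m IH]; intros H; [exists 0; lia|].
  destruct IH as [N1 H1]; [auto|]; destruct (H m) as [N2 H2]; [lia|].
  exists (N1 + N2); intros i k Hi Hk; destruct (Nat.eq_dec i m) as [->|];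
    [apply H2|apply H1]; lia.
Qed.

(* A halting computation reads only finitely many values of its oracle. *)
Lemma bev_converges P q c n v : lim P q -> eval q c n v ->
  exists N, forall i, N <= i -> bev (row P i) i c n = S v.
Proof.
  intros HP; revert n v; induction c; simpl; intros n v H;
    try (exists 0; intros; subst v; reflexivity).
  - destruct (HP n) as [N HN]; exists N; intros i Hi; unfold row.
    subst v; f_equal; auto.
  - destruct H as (x & y & Hx & Hy & ->).
    destruct (IHc1 _ _ Hx) as [N1 H1], (IHc2 _ _ Hy) as [N2 H2].
    exists (N1 + N2); intros i Hi; rewrite H1, H2 by lia; reflexivity.
  - destruct H as (x & Hx & Hy).
    destruct (IHc2 _ _ Hx) as [N1 H1], (IHc1 _ _ Hy) as [N2 H2].
    exists (N1 + N2); intros i Hi; rewrite H1 by lia; apply H2; lia.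
  - revert v H; change (fst (Cantor.of_nat n)) with (fstn n).
    change (snd (Cantor.of_nat n)) with (sndn n).
    induction (sndn n) as [|m IH]; simpl; intros v H; [auto|].
    destruct H as (u & Hu & Hv).
    destruct (IH _ Hu) as [N1 H1], (IHc2 _ _ Hv) as [N2 H2].
    exists (N1 + N2); intros i Hi; rewrite H1 by lia; apply H2; lia.
  - destruct H as [H0 L]; destruct (IHc _ _ H0) as [N0 H1].
    destruct (eventually_bounded (fun j i => exists u,
      bev (row P i) i c ⟪n, j⟫ = S (S u)) v) as [N2 H2].
    { intros j Hj; destruct (L j Hj) as [u Hu]; destruct (IHc _ _ Hu) as [N HN].
      exists N; intros; exists u; auto. }
    (* Past [N0] the test at [v] has settled, past [N2] the tests below it have, and S v rounds are
       enough to reach [v]. *)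
    exists (N0 + N2 + S v); intros b Hb.
    match goal with |- pred (prec _ ?B _) = _ => set (st := B) end.
    assert (I0 : forall k, k <= v -> prec 0 st k = 0).
    { induction k as [|k IH]; intros Hk; [reflexivity|].
      change (prec 0 st (S k)) with (st k (prec 0 st k)).
      rewrite IH by lia; unfold st; simpl.
      destruct (H2 k b) as [u Hu]; [lia|lia|]; now rewrite Hu. }
    assert (I1 : forall k, prec 0 st (S v + k) = S (S v)).
    { induction k as [|k IH].
      - rewrite Nat.add_0_r; change (prec 0 st (S v)) with (st v (prec 0 st v)).
        rewrite I0 by lia; unfold st; simpl; now rewrite H1 by lia.
      - rewrite Nat.add_succ_r.
        change (prec 0 st (S (S v + k))) with (st (S v + k) (prec 0 st (S v + k))).
        now rewrite IH. }
    replace b with (S v + (b - S v)) by lia; now rewrite I1.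
Qed.

Lemma lim_functional P q r : lim P q -> lim P r -> q = r.
Proof.
  intros Hq Hr; apply functional_extensionality; intros j.
  destruct (Hq j) as [N1 H1], (Hr j) as [N2 H2].
  rewrite <- (H1 (N1 + N2)), <- (H2 (N1 + N2)) by lia; reflexivity.
Qed.

Lemma miter_lim_functional m P q r : miter lim m P q -> miter lim m P r -> q = r.
Proof.
  revert q r; induction m as [|m IH]; intros q r; [now intros <- <-|].
  intros (_ & q' & Hq' & Hq) (_ & r' & Hr' & Hr).
  rewrite (IH _ _ Hr' Hq') in Hr; exact (lim_functional _ _ _ Hq Hr).
Qed.

(** The domain clause of [mcomp] speaks of all intermediate values, but iterated limits have at most
    one. *)
Lemma miter_lim_succ m P q r :
  miter lim m P q -> lim q r -> miter lim (S m) P r.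
Proof.
  intros Hq Hr; split; [|now exists q].
  intros q' Hq'; rewrite (miter_lim_functional m P q' q) by assumption; now exists r.
Qed.

(** Row [i] of [F P] runs [c] on row [i] of [P] with bound [i]. A run without result yields the
    default 0 through [pred]; each column of the output contains this default in only finitely many
    rows. *)
Lemma lim_computable_image c : exists F, total_computable F /\
  forall P q r, lim P q -> computes q c r -> lim (F P) r.
Proof.
  exists (fun P t => pred (bev (row P (fstn t)) (fstn t) c (sndn t))); split.
  - apply tc_pred, bev_computable.
  - intros P q r HP Hc j; destruct (bev_converges P q c j (r j) HP (Hc j)) as [N HN].
    exists N; intros i Hi; proj; now rewrite HN.
Qed.

(** Pulling [c] through the outermost limit turns it into a total computable operator, which the
    induction hypothesis pulls through the remaining ones. *)
Lemma miter_lim_computable_image m c : exists d, forall P q r,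
  miter lim m P q -> computes q c r ->
  exists s, computes P d s /\ miter lim m s r.
Proof.
  revert c; induction m as [|m IH]; intros c.
  - exists c; intros P q r <- Hc; exists r; now split.
  - destruct (lim_computable_image c) as (F & [a Ha] & HF).
    destruct (IH a) as [d Hd]; exists d; intros P q r (_ & q' & Hq' & Hq) Hc.
    destruct (Hd P q' (F q') Hq' (Ha q')) as (s & Hs & Hm).
    exists s; split; [exact Hs|].
    exact (miter_lim_succ _ _ _ _ Hm (HF _ _ _ Hq Hc)).
Qed.

(** * A universal machine *)

Lemma tag_S e : tag (S e) = cond (neqn (tag e) 8) 5 (S (tag e)).
Proof. reflexivity. Qed.

Lemma arg_S e : arg (S e) = cond (neqn (tag e) 8) (S (arg e)) (arg e).
Proof. reflexivity. Qed.

(** Compound codes have numbers 5 + r + 4 * x. From 5 on, [tag] runs cyclically through 5, 6, 7, 8,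
    and [arg] counts the completed cycles. *)
Lemma tag_arg r x e : r < 4 -> e = 5 + r + 4 * x -> tag e = 5 + r /\ arg e = x.
Proof.
  revert x r; induction e as [|e IH]; intros x r Hr E; [lia|].
  rewrite tag_S, arg_S; destruct r as [|r]; [destruct x as [|x]|].
  - replace e with 4 by lia; now split.
  - destruct (IH x 3) as [T A]; [lia|lia|]; rewrite T, A; now split.
  - destruct (IH x r) as [T A]; [lia|lia|].
    rewrite T, A, !cond_neq by lia; split; lia.
Qed.

(* A state either evaluates the code numbered [e] at [n] or returns a value [v],
   in both cases to a stack [K] of frames ⟪kind, ⟪data, rest⟫⟫; kind 0 is the
   empty stack. *)
Definition st_eval (e n K : nat) : nat := ⟪0, ⟪⟪e, n⟫, K⟫⟫.
Definition st_ret (v K : nat) : nat := ⟪1, ⟪v, K⟫⟫.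

Definition k_nil : nat := ⟪0, 0⟫.
Definition k_pairl (b n K : nat) : nat := ⟪1, ⟪⟪b, n⟫, K⟫⟫.
Definition k_pairr (x K : nat) : nat := ⟪2, ⟪x, K⟫⟫.
Definition k_comp (a K : nat) : nat := ⟪3, ⟪a, K⟫⟫.
Definition k_prec (b x i m K : nat) : nat := ⟪4, ⟪⟪b, ⟪x, ⟪i, m⟫⟫⟫, K⟫⟫.
Definition k_mu (a n i K : nat) : nat := ⟪5, ⟪⟪a, ⟪n, i⟫⟫, K⟫⟫.

Definition eval_step (p : Baire) (e n K : nat) : nat :=
  cond (neqn (tag e) 0) (st_ret 0 K)
  (cond (neqn (tag e) 1) (st_ret (S n) K)
  (cond (neqn (tag e) 2) (st_ret (fstn n) K)
  (cond (neqn (tag e) 3) (st_ret (sndn n) K)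
  (cond (neqn (tag e) 4) (st_ret (p n) K)
  (cond (neqn (tag e) 5)
     (st_eval (fstn (arg e)) n (k_pairl (sndn (arg e)) n K))
  (cond (neqn (tag e) 6) (st_eval (sndn (arg e)) n (k_comp (fstn (arg e)) K))
  (cond (neqn (tag e) 7)
     (st_eval (fstn (arg e)) (fstn n)
        (k_prec (sndn (arg e)) (fstn n) 0 (sndn n) K))
     (st_eval (arg e) ⟪n, 0⟫ (k_mu (arg e) n 0 K))))))))).

(** In a recursion frame (kind 4) the returned value is that of stage [i] out of [m]; in a search
    frame (kind 5, the default branch) it is the test of candidate [i]. *)
Definition frame_step (k d v K : nat) : nat :=
  cond (neqn k 1) (st_eval (fstn d) (sndn d) (k_pairr v K))
  (cond (neqn k 2) (st_ret ⟪d, v⟫ K)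
  (cond (neqn k 3) (st_eval d v K)
  (cond (neqn k 4)
    (cond (neqn (fstn (sndn (sndn d))) (sndn (sndn (sndn d)))) (st_ret v K)
      (st_eval (fstn d) ⟪fstn (sndn d), ⟪fstn (sndn (sndn d)), v⟫⟫
        (k_prec (fstn d) (fstn (sndn d)) (S (fstn (sndn (sndn d))))
           (sndn (sndn (sndn d))) K)))
    (cond v (st_ret (sndn (sndn d)) K)
      (st_eval (fstn d) ⟪fstn (sndn d), S (sndn (sndn d))⟫
        (k_mu (fstn d) (fstn (sndn d)) (S (sndn (sndn d))) K)))))).

Definition step (p : Baire) (s : nat) : nat :=
  cond (fstn s)
    (eval_step p (fstn (fstn (sndn s))) (sndn (fstn (sndn s))) (sndn (sndn s)))
    (frame_step (fstn (sndn (sndn s))) (fstn (sndn (sndn (sndn s))))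
       (fstn (sndn s)) (sndn (sndn (sndn (sndn s))))).

(** Zero exactly when a value is being returned to the empty stack. As [step] may leave such a state
    again, halting is phrased as being stopped at some time. *)
Definition running (s : nat) : nat := neqn (fstn s) 1 + fstn (sndn (sndn s)).

Lemma tc_step F : total_computable F -> total_computable (fun p n => step p (F p n)).
Proof.
  intros HF.
  unfold step, eval_step, frame_step, st_eval, st_ret, k_pairl, k_pairr, k_comp,
    k_prec, k_mu.
  tc.
Qed.

Lemma step_eval p e n K : step p (st_eval e n K) = eval_step p e n K.
Proof. unfold step, st_eval; proj; reflexivity. Qed.

Lemma step_frame p v k d K : step p (st_ret v ⟪k, ⟪d, K⟫⟫) = frame_step k d v K.
Proof. unfold step, st_ret; proj; reflexivity. Qed.

Section Machine.
Variable p : Baire.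

Ltac code_step r x :=
  intros; rewrite step_eval; unfold eval_step; cbn [encode];
  match goal with |- context [tag ?e] =>
    destruct (tag_arg r x e) as [T A]; [lia|reflexivity|]; rewrite T, A
  end; cbn; proj; reflexivity.

Lemma step_pair a b n K :
  step p (st_eval (encode (Pair a b)) n K) =
  st_eval (encode a) n (k_pairl (encode b) n K).
Proof. code_step 0 ⟪encode a, encode b⟫. Qed.

Lemma step_comp a b n K :
  step p (st_eval (encode (Comp a b)) n K) =
  st_eval (encode b) n (k_comp (encode a) K).
Proof. code_step 1 ⟪encode a, encode b⟫. Qed.

Lemma step_prec a b n K :
  step p (st_eval (encode (Prec a b)) n K) =
  st_eval (encode a) (fstn n) (k_prec (encode b) (fstn n) 0 (sndn n) K).
Proof. code_step 2 ⟪encode a, encode b⟫. Qed.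

Lemma step_mu a n K :
  step p (st_eval (encode (Mu a)) n K) =
  st_eval (encode a) ⟪n, 0⟫ (k_mu (encode a) n 0 K).
Proof. code_step 3 (encode a). Qed.

Lemma step_k_pairl b n v K : step p (st_ret v (k_pairl b n K)) = st_eval b n (k_pairr v K).
Proof. unfold k_pairl; rewrite step_frame; cbn; now proj. Qed.

Lemma step_k_pairr x v K : step p (st_ret v (k_pairr x K)) = st_ret ⟪x, v⟫ K.
Proof. unfold k_pairr; rewrite step_frame; reflexivity. Qed.

Lemma step_k_comp a v K : step p (st_ret v (k_comp a K)) = st_eval a v K.
Proof. unfold k_comp; rewrite step_frame; reflexivity. Qed.

Lemma step_k_prec b x i m v K :
  step p (st_ret v (k_prec b x i m K)) =
  cond (neqn i m) (st_ret v K) (st_eval b ⟪x, ⟪i, v⟫⟫ (k_prec b x (S i) m K)).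
Proof. unfold k_prec at 1; rewrite step_frame; unfold frame_step; proj; reflexivity. Qed.

Lemma step_k_mu a n i v K :
  step p (st_ret v (k_mu a n i K)) =
  cond v (st_ret i K) (st_eval a ⟪n, S i⟫ (k_mu a n (S i) K)).
Proof. unfold k_mu at 1; rewrite step_frame; unfold frame_step; proj; reflexivity. Qed.

Definition reach (s s' : nat) : Prop := exists t, Nat.iter t (step p) s = s'.

Lemma reach_refl s : reach s s.
Proof. now exists 0. Qed.

Lemma reach_step s s' : reach (step p s) s' -> reach s s'.
Proof. intros [t Ht]; exists (S t); now rewrite Nat.iter_succ_r. Qed.

Lemma reach_trans s s' s'' : reach s s' -> reach s' s'' -> reach s s''.
Proof. intros [t <-] [u <-]; exists (u + t); now rewrite Nat.iter_add. Qed.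

(** The stack [K] is arbitrary so that the induction hypotheses apply to subcomputations, which run
    on top of a pushed frame. *)
Lemma machine_complete c n v K :
  eval p c n v -> reach (st_eval (encode c) n K) (st_ret v K).
Proof.
  revert n v K; induction c; intros n v K H; cbn [eval] in H.
  1-5: apply reach_step; rewrite step_eval; subst v; apply reach_refl.
  - destruct H as (x & y & Hx & Hy & ->).
    apply reach_step; rewrite step_pair; eapply reach_trans; [apply IHc1, Hx|].
    apply reach_step; rewrite step_k_pairl; eapply reach_trans; [apply IHc2, Hy|].
    apply reach_step; rewrite step_k_pairr; apply reach_refl.
  - destruct H as (x & Hx & Hv).
    apply reach_step; rewrite step_comp; eapply reach_trans; [apply IHc2, Hx|].
    apply reach_step; rewrite step_k_comp; apply IHc1, Hv.
  - apply reach_step; rewrite step_prec.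
    fold (fstn n) in H; fold (sndn n) in H.
    assert (G : forall i u m, prec_graph (eval p c1) (eval p c2) (fstn n) i u -> i <= m ->
      reach (st_eval (encode c1) (fstn n) (k_prec (encode c2) (fstn n) 0 m K))
            (st_ret u (k_prec (encode c2) (fstn n) i m K))).
    { induction i as [|i IH]; intros u m G L; [apply IHc1, G|].
      destruct G as (w & Gw & Gu).
      eapply reach_trans; [apply (IH w m Gw); lia|].
      apply reach_step; rewrite step_k_prec, cond_neq by lia; apply IHc2, Gu. }
    eapply reach_trans; [apply (G _ _ _ H); lia|].
    apply reach_step; rewrite step_k_prec, cond_eq by reflexivity; apply reach_refl.
  - apply reach_step; rewrite step_mu; destruct H as [H0 L].
    assert (G : forall i, i <= v ->
      reach (st_eval (encode c) ⟪n, 0⟫ (k_mu (encode c) n 0 K))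
            (st_eval (encode c) ⟪n, i⟫ (k_mu (encode c) n i K))).
    { induction i as [|i IH]; intros Hi; [apply reach_refl|].
      eapply reach_trans; [apply IH; lia|].
      destruct (L i Hi) as [u Hu].
      eapply reach_trans; [apply IHc, Hu|].
      apply reach_step; rewrite step_k_mu; apply reach_refl. }
    eapply reach_trans; [apply (G v); lia|].
    eapply reach_trans; [apply IHc, H0|].
    apply reach_step; rewrite step_k_mu; apply reach_refl.
Qed.

Definition stops_in (t s : nat) : Prop := running (Nat.iter t (step p) s) = 0.

Lemma stops_in_eval t e n K :
  stops_in t (st_eval e n K) ->
  exists u, t = S u /\ stops_in u (step p (st_eval e n K)).
Proof.
  unfold stops_in; destruct t as [|u]; [|rewrite Nat.iter_succ_r; eauto].
  cbn [Nat.iter nat_rect]; unfold running, st_eval; proj; discriminate.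
Qed.

Lemma stops_in_frame t v k d K :
  stops_in t (st_ret v ⟪S k, ⟪d, K⟫⟫) ->
  exists u, t = S u /\ stops_in u (step p (st_ret v ⟪S k, ⟪d, K⟫⟫)).
Proof.
  unfold stops_in; destruct t as [|u]; [|rewrite Nat.iter_succ_r; eauto].
  cbn [Nat.iter nat_rect]; unfold running, st_ret; proj; discriminate.
Qed.

(** A run that stops must first return the value of [c] to [K], and [u] is the time left after that.
    The strict bound u < t drives the induction for searches. *)
Lemma machine_sound c n K t : stops_in t (st_eval (encode c) n K) ->
  exists v u, u < t /\ eval p c n v /\ stops_in u (st_ret v K).
Proof.
  revert n K t; induction c; intros n K t H;
    destruct (stops_in_eval _ _ _ _ H) as (t0 & -> & H0); clear H.
  1-5: rewrite step_eval in H0; do 2 eexists; split; [|split; [|exact H0]];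
    [lia|reflexivity].
  - rewrite step_pair in H0.
    destruct (IHc1 _ _ _ H0) as (x & t1 & L1 & Hx & H1).
    destruct (stops_in_frame _ _ _ _ _ H1) as (t2 & -> & H2).
    fold (k_pairl (encode c2) n K) in H2; rewrite step_k_pairl in H2.
    destruct (IHc2 _ _ _ H2) as (y & t3 & L3 & Hy & H3).
    destruct (stops_in_frame _ _ _ _ _ H3) as (t4 & -> & H4).
    fold (k_pairr x K) in H4; rewrite step_k_pairr in H4.
    exists ⟪x, y⟫, t4; split; [lia|split; [|exact H4]]; now exists x, y.
  - rewrite step_comp in H0.
    destruct (IHc2 _ _ _ H0) as (x & t1 & L1 & Hx & H1).
    destruct (stops_in_frame _ _ _ _ _ H1) as (t2 & -> & H2).
    fold (k_comp (encode c1) K) in H2; rewrite step_k_comp in H2.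
    destruct (IHc1 _ _ _ H2) as (y & t3 & L3 & Hy & H3).
    exists y, t3; split; [lia|split; [|exact H3]]; now exists x.
  - rewrite step_prec in H0; cbn [eval]; fold (fstn n) (sndn n).
    destruct (IHc1 _ _ _ H0) as (x & t1 & L1 & Hx & H1); clear H0.
    (* [d] is the number of recursion rounds still to be run. *)
    assert (G : forall d i w t,
      prec_graph (eval p c1) (eval p c2) (fstn n) i w -> i + d = sndn n ->
      stops_in t (st_ret w (k_prec (encode c2) (fstn n) i (sndn n) K)) ->
      exists v u, u < t /\ prec_graph (eval p c1) (eval p c2) (fstn n) (sndn n) v /\
        stops_in u (st_ret v K)).
    { induction d as [|d IH]; intros i w t Hw E Ht;
        destruct (stops_in_frame _ _ _ _ _ Ht) as (t' & -> & H');
        fold (k_prec (encode c2) (fstn n) i (sndn n) K) in H';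
        rewrite step_k_prec in H'.
      - rewrite cond_eq in H' by lia; exists w, t'.
        replace i with (sndn n) in Hw by lia; auto.
      - rewrite cond_neq in H' by lia.
        destruct (IHc2 _ _ _ H') as (w' & t2 & L2 & Hw' & H2).
        destruct (IH (S i) w' t2) as (v & u & Lu & Hv & Hu);
          [now exists w|lia|exact H2|].
        exists v, u; split; [lia|auto]. }
    destruct (G (sndn n) 0 x t1 Hx eq_refl H1) as (v & u & Lu & Hv & Hu).
    exists v, u; split; [lia|auto].
  - rewrite step_mu in H0; cbn [eval].
    (* The number of candidates to be tested is not known in advance, so the induction is on the
       running time, which drops with each test. *)
    assert (G : forall t i, (forall j, j < i -> exists u, eval p c ⟪n, j⟫ (S u)) ->
      stops_in t (st_eval (encode c) ⟪n, i⟫ (k_mu (encode c) n i K)) ->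
      exists v u, u < t /\ (eval p c ⟪n, v⟫ 0 /\
        forall j, j < v -> exists u, eval p c ⟪n, j⟫ (S u)) /\
        stops_in u (st_ret v K)).
    { induction t as [t IH] using (well_founded_induction lt_wf); intros i Hi Ht.
      destruct (IHc _ _ _ Ht) as (w & t1 & L1 & Hw & H1).
      destruct (stops_in_frame _ _ _ _ _ H1) as (t2 & -> & H2).
      fold (k_mu (encode c) n i K) in H2; rewrite step_k_mu in H2.
      destruct w as [|w]; cbn [cond] in H2.
      - exists i, t2; split; [lia|auto].
      - destruct (IH t2) with (i := S i) as (v & u & Lu & Hv & Hu);
          [lia| |exact H2|exists v, u; split; [lia|auto]].
        intros j Hj; destruct (Nat.eq_dec j i) as [->|]; [eauto|apply Hi; lia]. }
    destruct (G t0 0 ltac:(lia) H0) as (v & u & Lu & Hv & Hu).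
    exists v, u; split; [lia|auto].
Qed.

Lemma machine_halts c n :
  (exists t, stops_in t (st_eval (encode c) n k_nil)) <-> exists v, eval p c n v.
Proof.
  split.
  - intros [t Ht]; apply machine_sound in Ht; destruct Ht as (v & _ & _ & Hv & _).
    now exists v.
  - intros [v Hv]; apply (machine_complete c n v k_nil) in Hv.
    destruct Hv as [t Ht]; exists t; unfold stops_in; rewrite Ht.
    unfold running, st_ret, k_nil; now proj.
Qed.

End Machine.

(** The code searches for a time at which the machine, started with code number [e] on input [e], is
    stopped; every [e] is a code number by [encode_surj]. *)
Lemma halting_code : exists c, forall p e, (exists v, eval p c e v) <-> halts p e.
Proof.
  destruct (eval_mu_halts (fun p s =>
    running (prec (st_eval (fstn s) (fstn s) k_nil) (fun _ => step p) (sndn s))))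
    as [c Hc].
  { unfold running.
    assert (H : total_computable (fun p s =>
      prec (st_eval (fstn s) (fstn s) k_nil) (fun _ => step p) (sndn s))).
    { apply (tc_prec (fun p s => st_eval (fstn s) (fstn s) k_nil)
        (fun p _ _ u => step p u) (fun _ s => sndn s)); [unfold st_eval; tc| |tc].
      apply tc_step; tc. }
    apply tc_add; [apply tc_neqn; [apply tc_fstn, H|tc]|].
    apply tc_fstn, tc_sndn, tc_sndn, H. }
  exists c; intros p e; rewrite Hc.
  destruct (encode_surj e) as [d Hd].
  transitivity (exists t, stops_in p t (st_eval (encode d) e k_nil)).
  - rewrite Hd; split; intros [t Ht]; exists t; revert Ht; proj; now intros.
  - rewrite machine_halts; split.
    + intros [v Hv]; now exists d, v.
    + intros (d' & v & E & Hv); exists v; rewrite <- Hd in E.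
      apply encode_inj in E; now subst d'.
Qed.

(** * The jump *)

Lemma J_spec p e : J p e = 1 <-> halts p e.
Proof.
  unfold J; destruct (excluded_middle_informative (halts p e)); split; easy.
Qed.

Lemma J_le1 p e : J p e <= 1.
Proof. unfold J; destruct (excluded_middle_informative (halts p e)); lia. Qed.

Lemma J_eq p q e d : (halts p e <-> halts q d) -> J p e = J q d.
Proof.
  intros H; unfold J.
  destruct (excluded_middle_informative (halts p e)),
    (excluded_middle_informative (halts q d)); tauto.
Qed.

(** Row [i] records whether bounded evaluation with bound [i] finds [e] halting: eventually yes if
    it halts by [bev_converges], never otherwise by [bev_sound]. *)
Lemma J_limit_computable : exists F, total_computable F /\ forall p, lim (F p) (J p).
Proof.
  destruct halting_code as [c Hc].
  exists (fun p t => cond (bev p (fstn t) c (sndn t)) 0 1); split.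
  - apply tc_cond; [|tc|tc].
    (* The array all of whose rows are [p] has limit [p]; through it the results on [bev] along rows
       apply to the fixed oracle [p]. *)
    assert (E : total_computable (fun p t => p (sndn t))) by tc.
    eapply tc_ext; [|exact (tc_subst _ _ (bev_computable c) E)].
    intros p n; cbv beta.
    replace (row (fun t => p (sndn t)) (fstn n)) with p; [reflexivity|].
    apply functional_extensionality; intros j; unfold row; now proj.
  - intros p e.
    destruct (classic (halts p e)) as [H|H].
    + rewrite (proj2 (J_spec p e) H).
      apply Hc in H; destruct H as [v Hv].
      destruct (bev_converges (fun t => p (sndn t)) p c e v) as [N HN];
        [intros j; exists 0; intros; now proj|exact Hv|].
      exists N; intros i Hi; proj.
      specialize (HN i Hi).
      replace (row (fun t => p (sndn t)) i) with p in HN; [now rewrite HN|].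
      apply functional_extensionality; intros j; unfold row; now proj.
    + exists 0; intros i _; proj.
      pose proof (J_le1 p e); rewrite <- J_spec in H.
      destruct (bev p i c e) as [|v] eqn:E; cbn [cond]; [lia|].
      apply bev_sound in E; destruct H; apply J_spec, Hc; eauto.
Qed.

Fixpoint const_code (n : nat) : code :=
  match n with 0 => Zero | S n => Comp Succ (const_code n) end.

Lemma eval_const_code p n x v : eval p (const_code n) x v <-> v = n.
Proof.
  revert v; induction n as [|n IH]; intros v; simpl; [tauto|].
  split; [intros (y & Hy & ->); f_equal; now apply IH|].
  intros ->; exists n; split; [now apply IH|reflexivity].
Qed.

Lemma tc_encode_comp a F : total_computable F ->
  total_computable (fun p n => 6 + 4 * ⟪encode a, F p n⟫).
Proof.
  intros HF.
  assert (H : total_computable (fun p n => ⟪encode a, F p n⟫)) by tc.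
  eapply tc_ext; [|exact (tc_add _ _ (tc_const 6)
    (tc_add _ _ H (tc_add _ _ H (tc_add _ _ H H))))].
  intros p n; simpl; lia.
Qed.

Lemma tc_encode_const : total_computable (fun _ n => encode (const_code n)).
Proof.
  eapply tc_ext; [|exact (tc_prec (fun _ _ => 0)
    (fun _ _ _ u => 6 + 4 * ⟪encode Succ, u⟫) (fun _ n => n) (tc_const 0)
    (tc_encode_comp Succ _ (tc_sndn _ (tc_sndn _ tc_id))) tc_id)].
  intros p n; cbv beta; induction n as [|n IH]; [reflexivity|].
  change (encode (const_code (S n)))
    with (6 + 4 * ⟪encode Succ, encode (const_code n)⟫).
  now rewrite <- IH.
Qed.

(* An instance of the s-m-n theorem: the code [Comp c (const_code n)] halts
   on its own number iff [c] halts on [n]. *)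
Lemma J_decides_halting c : exists ix, total_computable (fun _ => ix) /\
  forall p n, J p (ix n) = 1 <-> exists v, eval p c n v.
Proof.
  exists (fun n => encode (Comp c (const_code n))); split.
  - exact (tc_encode_comp c _ tc_encode_const).
  - intros p n; rewrite J_spec; unfold halts; split.
    + intros (d & v & E & Hv); apply encode_inj in E; subst d.
      destruct Hv as (x & Hx & Hv); apply eval_const_code in Hx; subst x; eauto.
    + intros [v Hv]; do 2 eexists; split; [reflexivity|].
      exists n; split; [now apply eval_const_code|exact Hv].
Qed.

(** The equation p n = v is posed as a halting question, which [J p] answers; the search then
    returns the least [v] with a positive answer, which is [p n]. *)
Lemma oracle_from_J : exists c, forall p, computes (J p) c p.
Proof.
  destruct (eval_mu_halts (fun p t => neqn (p (fstn (fstn t))) (sndn (fstn t))))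
    as [c Hc]; [tc|].
  destruct (J_decides_halting c) as (ix & Hix & HJ).
  destruct (eval_mu (fun w t => neqn (w (ix t)) 1)) as [d Hd].
  { apply tc_neqn; [apply tc_oracle, Hix|tc]. }
  assert (E : forall p n v, neqn (J p (ix ⟪n, v⟫)) 1 = 0 <-> p n = v).
  { intros p n v; rewrite neqn_0, HJ, Hc; proj.
    split; [intros [u Hu]; revert Hu; proj; apply neqn_0|].
    intros H; exists 0; proj; now apply neqn_0. }
  exists d; intros p n; apply Hd; rewrite E; split; [reflexivity|].
  intros i Hi; rewrite E; lia.
Qed.

(* The least row index from which column [j] is constant is computable from the
   jump, and row and column determine the limit. *)
Lemma lim_from_J : exists c, forall p q, lim p q -> computes (J p) c q.
Proof.
  (* This code halts on ⟪j, i⟫ iff some row from [i] on differs from row [i] in column [j], so a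
     jump value 0 says that the column is constant from there. *)
  destruct (eval_mu_halts (fun p t =>
    cond (neqn (p ⟪sndn (fstn t), fstn (fstn t)⟫)
               (p ⟪sndn (fstn t) + sndn t, fstn (fstn t)⟫)) 1 0))
    as [c Hc]; [tc|].
  destruct (J_decides_halting c) as (ix & Hix & HJ).
  destruct (eval_mu (fun w t => w (ix t))) as [d Hd]; [apply tc_oracle, Hix|].
  destruct oracle_from_J as [a Ha].
  (* [Pair Left Right] is the identity, so the inner code forms ⟪i, j⟫, and [a] looks up [p]
     there. *)
  exists (Comp a (Pair d (Pair Left Right))); intros p q Hq j.
  assert (E : forall i, J p (ix ⟪j, i⟫) = 0 <-> forall k, p ⟪i, j⟫ = p ⟪i + k, j⟫).
  { intros i.
    transitivity (~ J p (ix ⟪j, i⟫) = 1);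
      [pose proof (J_le1 p (ix ⟪j, i⟫)); lia|].
    rewrite HJ, Hc; split.
    - intros H k; apply NNPP; intros N; apply H; exists k; proj.
      now rewrite cond_neq.
    - intros H [k Hk]; revert Hk; proj; rewrite cond_eq by apply H; discriminate. }
  destruct (least_witness (fun i => J p (ix ⟪j, i⟫) = 0)) as (i & H0 & L).
  { destruct (Hq j) as [N HN]; exists N; apply E; intros k.
    rewrite !HN by lia; reflexivity. }
  replace (q j) with (p ⟪i, j⟫).
  - exists ⟪i, j⟫; split; [|apply Ha].
    exists i, j; split; [now apply Hd|split; [|reflexivity]].
    exists (fstn j), (sndn j); repeat split; now rewrite pair_surj.
  - destruct (Hq j) as [N HN]; rewrite <- (HN (i + N)) by lia.
    now apply E.
Qed.

(** Substituting [c] for the oracle of the universal code turns halting relative to [q] into halting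
    relative to [p], so one query to [J p] decides [J q e]. *)
Lemma J_mono c : exists d, forall p q, computes p c q -> computes (J p) d (J q).
Proof.
  destruct halting_code as [h Hh].
  destruct (J_decides_halting (subst h c)) as (ix & Hix & HJ).
  destruct (tc_oracle _ Hix) as [d Hd]; exists d; intros p q Hc e.
  replace (J q e) with (J p (ix e)); [apply Hd|].
  apply J_eq; rewrite <- J_spec, HJ, <- Hh.
  split; intros [v Hv]; exists v; apply (eval_subst p q h c e v Hc), Hv.
Qed.

Lemma J_injective p q : J p = J q -> p = q.
Proof.
  destruct oracle_from_J as [c Hc]; intros E.
  apply (computes_functional (J p) c); [apply Hc|rewrite E; apply Hc].
Qed.

Lemma iter_J_injective k p q : Nat.iter k J p = Nat.iter k J q -> p = q.
Proof.
  induction k as [|k IH]; [auto|]; intros H; now apply IH, J_injective.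
Qed.

(** Injectivity of the iterated jump makes the intermediate value unique, which settles the domain
    clause of [mcomp]. *)
Lemma miter_Jinv k w r : miter Jinv k w r <-> Nat.iter k J r = w.
Proof.
  revert r; induction k as [|k IH]; intros r; [split; intros H; symmetry; exact H|].
  rewrite Nat.iter_succ_r; split.
  - intros (_ & u & Hu & <-); now apply IH.
  - intros H; split; [|exists (J r); split; [now apply IH|reflexivity]].
    intros u Hu; exists r; apply IH in Hu; unfold Jinv; subst w.
    symmetry; exact (iter_J_injective _ _ _ Hu).
Qed.

Lemma iter_J_mono k c : exists d, forall p q,
  computes p c q -> computes (Nat.iter k J p) d (Nat.iter k J q).
Proof.
  induction k as [|k [d Hd]]; [now exists c|].
  destruct (J_mono d) as [d' Hd']; exists d'; intros p q H; apply Hd', Hd, H.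
Qed.

Lemma oracle_from_iter_J k : exists c, forall p, computes (Nat.iter k J p) c p.
Proof.
  induction k as [|k [c Hc]]; [now exists Oracle|].
  destruct oracle_from_J as [a Ha]; exists (subst c a); intros p.
  exact (computes_subst _ _ _ _ _ (Ha _) (Hc p)).
Qed.

(** Each further jump pays for one further limit: if [t] is computable from J^k(p), then [J t] is
    computable from J^(k+1)(p), and it computes the limit of [t]. *)
Lemma miter_lim_from_iter_J k : exists c, forall p q,
  miter lim k p q -> computes (Nat.iter k J p) c q.
Proof.
  induction k as [|k [c Hc]]; [exists Oracle; now intros p q <-|].
  destruct (J_mono c) as [d Hd], lim_from_J as [a Ha].
  exists (subst a d); intros p q (_ & t & Ht & Hq).
  exact (computes_subst _ _ _ _ _ (Hd _ _ (Hc _ _ Ht)) (Ha _ _ Hq)).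
Qed.

(** The last jump is the limit of a computable operator applied to J^k(p), and that operator can be
    pulled inside the [k] limits already obtained. *)
Lemma iter_J_limit_computable k : exists d, forall p,
  exists s, computes p d s /\ miter lim k s (Nat.iter k J p).
Proof.
  induction k as [|k [d Hd]]; [exists Oracle; intros p; now exists p|].
  destruct J_limit_computable as (F & [a Ha] & HF).
  destruct (miter_lim_computable_image k a) as [b Hb].
  exists (subst b d); intros p; destruct (Hd p) as (s & Hs & Hm).
  destruct (Hb _ _ _ Hm (Ha _)) as (s' & Hs' & Hm').
  exists s'; split; [exact (computes_subst _ _ _ _ _ Hs Hs')|].
  exact (miter_lim_succ _ _ _ _ Hm' (HF _)).
Qed.

(** * Joins *)

Lemma join_even p q n : join p q (n + n) = p n.
Proof.
  unfold join; replace (n + n) with (2 * n) by lia.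
  now rewrite Nat.even_even, Nat.div2_double.
Qed.

Lemma join_odd p q n : join p q (S (n + n)) = q n.
Proof.
  unfold join; replace (S (n + n)) with (2 * n + 1) by lia.
  rewrite Nat.even_odd, Nat.add_1_r, Nat.div2_succ_double; reflexivity.
Qed.

(** Halving as a recursion over the available operations: the count goes up exactly when [i] is
    odd. *)
Definition half (n : nat) : nat :=
  prec 0 (fun i u => cond (neqn (u + u) i) u (S u)) n.

Lemma half_spec n : n = half n + half n \/ n = S (half n + half n).
Proof.
  induction n as [|n IH]; [now left|].
  change (half (S n)) with (cond (neqn (half n + half n) n) (half n) (S (half n))).
  destruct IH as [E|E]; [rewrite cond_eq by lia|rewrite cond_neq by lia]; lia.
Qed.

Lemma join_half p q n :
  join p q n = cond (neqn (half n + half n) n) (p (half n)) (q (half n)).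
Proof.
  destruct (half_spec n) as [E|E].
  - rewrite cond_eq by lia; rewrite E at 1; apply join_even.
  - rewrite cond_neq by lia; rewrite E at 1; apply join_odd.
Qed.

Lemma tc_half F : total_computable F -> total_computable (fun p n => half (F p n)).
Proof. intros HF; unfold half; tc. Qed.

(** The codes [c] and [d] are only known to be total on the given oracle [w], so the closure lemmas
    do not apply to them. Both values at [half n] are computed and a total operator [s] selects
    one. *)
Lemma computes_join c d : exists e, forall w p q,
  computes w c p -> computes w d q -> computes w e (join p q).
Proof.
  destruct (tc_half _ tc_id) as [h Hh].
  assert (H : total_computable (fun _ t =>
    cond (neqn (half (sndn t) + half (sndn t)) (sndn t)) (fstn (fstn t)) (sndn (fstn t)))).
  { assert (total_computable (fun _ t => half (sndn t))) by (apply tc_half; tc); tc. }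
  destruct H as [s Hs].
  exists (Comp s (Pair (Pair (Comp c h) (Comp d h)) (Pair Left Right))).
  intros w p q Hc Hd n.
  exists ⟪⟪p (half n), q (half n)⟫, n⟫; split.
  - exists ⟪p (half n), q (half n)⟫, n; split; [|split; [|reflexivity]].
    + exists (p (half n)), (q (half n)); split; [|split; [|reflexivity]];
        exists (half n); (split; [apply Hh|]); auto.
    + exists (fstn n), (sndn n); repeat split; now rewrite pair_surj.
  - specialize (Hs w ⟪⟪p (half n), q (half n)⟫, n⟫); revert Hs; cbv beta; proj.
    now rewrite join_half.
Qed.

Lemma join_right_computable : exists c, forall p q, computes (join p q) c q.
Proof.
  assert (H : total_computable (fun w n => w (S (n + n)))) by tc.
  destruct H as [c Hc]; exists c; intros p q n; rewrite <- (join_odd p q n).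
  apply (Hc (join p q)).
Qed.

(** Carries the input [p] through the limits by copying it into every row. This makes [p] available
    behind a strong reduction, whose outer computation sees only the limit. *)
Lemma miter_lim_join m : exists d, forall p P w, miter lim m P w ->
  exists s, computes (join p P) d s /\ miter lim m s (join p w).
Proof.
  induction m as [|m [d Hd]].
  - exists Oracle; intros p P w <-; now exists (join p P).
  - assert (H : total_computable (fun u t =>
      cond (neqn (half (sndn t) + half (sndn t)) (sndn t))
        (u (half (sndn t) + half (sndn t)))
        (u (S (⟪fstn t, half (sndn t)⟫ + ⟪fstn t, half (sndn t)⟫))))).
    { assert (total_computable (fun _ t => half (sndn t))) by (apply tc_half; tc); tc. }
    destruct H as [a Ha].
    destruct (miter_lim_computable_image m a) as [b Hb].
    exists (subst b d); intros p P w (_ & w' & Hw' & Hw).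
    destruct (Hd p P w' Hw') as (s & Hs & Hm).
    destruct (Hb _ _ _ Hm (Ha _)) as (s' & Hs' & Hm').
    exists s'; split; [exact (computes_subst _ _ _ _ _ Hs Hs')|].
    apply (miter_lim_succ _ _ _ _ Hm').
    intros j; destruct (Hw (half j)) as [N HN]; exists N; intros i Hi; proj.
    now rewrite join_even, join_odd, HN, join_half by lia.
Qed.

(** * Weihrauch reductions *)

(** The largest partial function that [c] computes, chosen classically. *)
Definition pfun_of_code (c : code) : pfun := fun p =>
  match excluded_middle_informative (exists q, computes p c q) with
  | left H => Some (proj1_sig (constructive_indefinite_description _ H))
  | right _ => None
  end.

Lemma pfun_of_code_spec c p q : pfun_of_code c p = Some q <-> computes p c q.
Proof.
  unfold pfun_of_code; destruct (excluded_middle_informative _) as [H|H].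
  - destruct (constructive_indefinite_description _ H) as [r Hr]; simpl; split.
    + now intros [= <-].
    + intros Hq; f_equal; exact (computes_functional _ _ _ _ Hr Hq).
  - split; [discriminate|]; intros Hq; destruct H; eauto.
Qed.

Lemma pfun_of_code_computable c : computable (pfun_of_code c).
Proof. exists c; intros p q H; now apply pfun_of_code_spec in H. Qed.

(** A realizer may take arbitrary values off the domain of [f]. Being undefined there makes each
    value a correct one, so a reduction tested on this [G] must query inside the domain. *)
Lemma exact_realizer (f : multifun baire_space baire_space) :
  exists G, realizes G f /\ forall p q, G p = Some q -> f p q.
Proof.
  exists (fun p => match excluded_middle_informative (exists q, f p q) with
    | left H => Some (proj1_sig (constructive_indefinite_description _ H))
    | right _ => None
    end); split.
  - intros p x [= <-] H; destruct (excluded_middle_informative _) as [H'|]; [|easy].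
    destruct (constructive_indefinite_description _ H') as [r Hr]; now exists r, r.
  - intros p q; destruct (excluded_middle_informative _) as [H'|]; [|easy].
    destruct (constructive_indefinite_description _ H') as [r Hr]; now intros [= <-].
Qed.

Lemma Low_spec k n P r : Low k n P r <-> miter lim (n + k) P (Nat.iter k J r).
Proof.
  split.
  - intros (_ & w & Hw & Hr); apply miter_Jinv in Hr; now rewrite Hr.
  - intros H; split; [|exists (Nat.iter k J r); split; [exact H|now apply miter_Jinv]].
    intros w Hw; exists r; apply miter_Jinv.
    exact (miter_lim_functional _ _ _ _ H Hw).
Qed.

Lemma realizer_unique G (f : multifun baire_space baire_space) p q :
  (forall r, f p r -> r = q) -> f p q -> realizes G f -> G p = Some q.
Proof.
  intros U Hq HG; destruct (HG p p eq_refl) as (r & r' & E & [= <-] & Hr); [now exists q|].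
  now rewrite E, (U r Hr).
Qed.

Lemma weihrauch_le_elim {X Y : repspace} (f : multifun X Y)
    (g : multifun baire_space baire_space) :
  weihrauch_le f g -> exists h c, forall p x, rep X p = Some x -> dom f x ->
    exists P w q y, computes p c P /\ g P w /\ computes (join p w) h q /\
      rep Y q = Some y /\ f x y.
Proof.
  intros (H & K & [h Hh] & [c Hc] & R); exists h, c; intros p x Hp Hx.
  destruct (exact_realizer g) as (G & HG & EG).
  destruct (R G HG p x Hp Hx) as (q & y & E & Hq & Hy); unfold pcomp in E.
  destruct (K p) as [P|] eqn:EK; [|discriminate].
  destruct (G P) as [w|] eqn:EP; [|discriminate].
  exists P, w, q, y; repeat split; auto; intros n; [eapply Hc|eapply Hh]; eauto.
Qed.

Lemma strong_weihrauch_le_elim {X Y : repspace} (f : multifun X Y)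
    (g : multifun baire_space baire_space) :
  strong_weihrauch_le f g -> exists h c, forall p x, rep X p = Some x -> dom f x ->
    exists P w q y, computes p c P /\ g P w /\ computes w h q /\
      rep Y q = Some y /\ f x y.
Proof.
  intros (H & K & [h Hh] & [c Hc] & R); exists h, c; intros p x Hp Hx.
  destruct (exact_realizer g) as (G & HG & EG).
  destruct (R G HG p x Hp Hx) as (q & y & E & Hq & Hy); unfold pcomp in E.
  destruct (K p) as [P|] eqn:EK; [|discriminate].
  destruct (G P) as [w|] eqn:EP; [|discriminate].
  exists P, w, q, y; repeat split; auto; intros n; [eapply Hc|eapply Hh]; eauto.
Qed.

(** As [miter lim m] is single-valued, every realizer answers [P] with the same [w]. *)
Lemma weihrauch_le_intro {X Y : repspace} (f : multifun X Y) m h c :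
  (forall p x, rep X p = Some x -> dom f x ->
    exists P w q y, computes p c P /\ miter lim m P w /\ computes (join p w) h q /\
      rep Y q = Some y /\ f x y) -> succ_computable m f.
Proof.
  intros R; exists (pfun_of_code h), (pfun_of_code c).
  split; [apply pfun_of_code_computable|split; [apply pfun_of_code_computable|]].
  intros G HG p x Hp Hx.
  destruct (R p x Hp Hx) as (P & w & q & y & HP & Hw & Hq & Hy & Hf).
  exists q, y; split; [|auto]; unfold pcomp.
  rewrite (proj2 (pfun_of_code_spec _ _ _) HP).
  rewrite (realizer_unique G (miter lim m) P w);
    [now apply pfun_of_code_spec| |exact Hw|exact HG].
  intros r Hr; exact (miter_lim_functional _ _ _ _ Hr Hw).
Qed.

Lemma succ_low_mcomp (X Y Z : repspace) (f : multifun X Y) (g : multifun Y Z) n k :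
  succ_low n k f -> succ_computable k g -> succ_computable (n + k) (mcomp g f).
Proof.
  intros Hf Hg.
  destruct (strong_weihrauch_le_elim _ _ Hf) as (h & c & Rf).
  destruct (weihrauch_le_elim _ _ Hg) as (h' & c' & Rg).
  destruct (oracle_from_iter_J k) as [a Ha].
  destruct (iter_J_mono k (subst c' h)) as [b Hb].
  destruct (miter_lim_from_iter_J k) as [l Hl].
  (* From J^k(r), [subst h a] computes the name [q] of a value of [f] via [r], and [subst l b]
     computes the iterated limit [t] needed by [g], via J^k(s). *)
  destruct (computes_join (subst h a) (subst l b)) as [e He].
  destruct join_right_computable as [d Hd].
  apply (weihrauch_le_intro _ _ (subst (subst h' e) d) c).
  intros p x Hp (z & Hz & y0 & Hy0 & _).
  destruct (Rf p x Hp (ex_intro _ y0 Hy0)) as (P & r & q & y & HP & Hr & Hq & Hy & Hxy).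
  apply Low_spec in Hr.
  destruct (Rg q y Hy (Hz y Hxy)) as (s & t & q' & z' & Hs & Ht & Hq' & Hz' & Hyz).
  exists P, (Nat.iter k J r), q', z'; split; [exact HP|split; [exact Hr|]].
  split; [|split; [exact Hz'|split; [exact Hz|now exists y]]].
  apply (computes_subst _ _ _ _ _ (Hd p _)).
  refine (computes_subst _ _ _ _ _ (He _ q t _ _) Hq').
  - exact (computes_subst _ _ _ _ _ (Ha r) Hq).
  - apply (computes_subst _ (Nat.iter k J s)); [|now apply Hl].
    apply Hb; exact (computes_subst _ _ _ _ _ Hq Hs).
Qed.

Definition jump_of_name (Y : repspace) (k : nat) : multifun Y baire_space :=
  fun y w => exists q, rep Y q = Some y /\ w = Nat.iter k J q.

(** The given name [p] of the point serves as its own witness, and the outer computation just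
    returns the iterated limit. *)
Lemma jump_of_name_computable Y k : succ_computable k (jump_of_name Y k).
Proof.
  destruct (iter_J_limit_computable k) as [c Hc], join_right_computable as [d Hd].
  apply (weihrauch_le_intro _ _ d c); intros p y Hp _.
  destruct (Hc p) as (s & Hs & Hm).
  exists s, (Nat.iter k J p), (Nat.iter k J p), (Nat.iter k J p).
  repeat split; [exact Hs|exact Hm|apply Hd|now exists p].
Qed.

Lemma succ_low_of_jump (X Y : repspace) (f : multifun X Y) n k :
  succ_computable (n + k) (mcomp (jump_of_name Y k) f) -> succ_low n k f.
Proof.
  intros R; destruct (weihrauch_le_elim _ _ R) as (h & c & Hf).
  (* The input is turned into join p P by [e], then [d] moves [p] inside the limits and [b] pulls
     [h] inside them. *)
  destruct (computes_join Oracle c) as [e He].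
  destruct (miter_lim_join (n + k)) as [d Hd].
  destruct (miter_lim_computable_image (n + k) h) as [b Hb].
  (* The outer function is the identity, since [Low] itself undoes the jumps and returns the
     name. *)
  exists (@Some Baire), (pfun_of_code (subst b (subst d e))).
  split; [exists Oracle; now intros p q [= ->]|].
  split; [apply pfun_of_code_computable|].
  intros G HG p x Hp [y0 Hy0].
  (* Every point has a name, so the composition with [jump_of_name] has the same domain as [f]. *)
  assert (Hdom : forall y, f x y -> dom (jump_of_name Y k) y).
  { intros y _; destruct (rep_surj Y y) as [q Hq]; exists (Nat.iter k J q); now exists q. }
  destruct (Hf p x Hp) as
    (P & w & w' & w'' & HP & Hw & Hw' & [= <-] & _ & y & Hxy & q & Hq & ->).
  { destruct (Hdom y0 Hy0) as [v Hv]; exists v; split; [exact Hdom|now exists y0]. }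
  destruct (Hd p P w Hw) as (s & Hs & Hm).
  destruct (Hb _ _ _ Hm Hw') as (s' & Hs' & Hm').
  exists q, y; split; [|auto]; unfold pcomp.
  rewrite (proj2 (pfun_of_code_spec _ p s')).
  - rewrite (realizer_unique G (Low k n) s' q); [reflexivity| |now apply Low_spec|exact HG].
    intros r Hr; apply Low_spec in Hr; apply (iter_J_injective k).
    exact (miter_lim_functional _ _ _ _ Hr Hm').
  - refine (computes_subst _ _ _ _ _ (computes_subst _ _ _ _ _ (He p p P _ HP) Hs) Hs').
    now intros i.
Qed.

Theorem theorem8p6 (X Y : repspace) (f : multifun X Y) (n k : nat) :
  succ_low n k f <->
  (forall (Z : repspace) (g : multifun Y Z),
     succ_computable k g -> succ_computable (n + k) (mcomp g f)).
Proof.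
  split.
  - intros Hf Z g; exact (succ_low_mcomp X Y Z f g n k Hf).
  - intros H; apply succ_low_of_jump, H, jump_of_name_computable.
Qed.
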